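(* Let $(\mathcal{A},\boxtimes,I,\otimes,K)$ be a lax $2$-monoidal category such that $(\mathcal{A},\boxtimes,I)$ admits free monoids; denote by $\mathcal{F}(V)$ the free $\boxtimes$-monoid on an object $V$. Then for objects $V$ and $W$ of $\mathcal{A}$ there exists a natural morphism of $\boxtimes$-monoids $\Phi:\mathcal{F}(V\otimes W)\to\mathcal{F}(V)\otimes\mathcal{F}(W)$.
   Context: A lax $2$-monoidal category is a category $(\mathcal{A},\boxtimes,I,\otimes,K)$ such that $(\mathcal{A},\boxtimes,I)$ and $(\mathcal{A},\otimes,K)$ are both monoidal categories and the bifunctor $\otimes:\mathcal{A}\times\mathcal{A}\to\mathcal{A}$ is a lax monoidal functor with respect to $\boxtimes^2$ on $\mathcal{A}\times\mathcal{A}$ (componentwise $\boxtimes$, with unit $(I,I)$) and $\boxtimes$ on $\mathcal{A}$. Concretely, there are a map $\iota:I\to I\otimes I$ and a natural transformation (interchange law) $\varphi_{A,A',B,B'}:(A\otimes A')\boxtimes(B\otimes B')\to(A\boxtimes B)\otimes(A'\boxtimes B')$ satisfying the usual associativity and unit coherence conditions of a lax monoidal functor. If $M$ and $N$ are $\boxtimes$-monoids, $M\otimes N$ is a $\boxtimes$-monoid with product $(M\otimes N)\boxtimes(M\otimes N)\xrightarrow{\varphi}(M\boxtimes M)\otimes(N\boxtimes N)\xrightarrow{\mu_M\otimes\mu_N}M\otimes N$ and unit $I\xrightarrow{\iota}I\otimes I\xrightarrow{u_M\otimes u_N}M\otimes N$; this is the monoid structure on $\mathcal{F}(V)\otimes\mathcal{F}(W)$.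 ''Admits free monoids'' means that the forgetful functor from $\boxtimes$-monoids to $\mathcal{A}$ has a left adjoint $\mathcal{F}$. *)

(* Defs.v *)
From Stdlib Require Import ssreflect ssrfun ProofIrrelevance.

Set Implicit Arguments.
Unset Strict Implicit.
Unset Printing Implicit Defensive.

Declare Scope cat_scope.
Delimit Scope cat_scope with cat.
Local Open Scope cat_scope.

Record category : Type := Category {
  ob :> Type;
  hom : ob -> ob -> Type;
  idm : forall a, hom a a;
  comp : forall a b c, hom b c -> hom a b -> hom a c;
  comp_idl : forall a b (f : hom a b), comp (idm b) f = f;
  comp_idr : forall a b (f : hom a b), comp f (idm a) = f;
  comp_assoc : forall a b c d (h : hom c d) (g : hom b c) (f : hom a b),
    comp h (comp g f) = comp (comp h g) f }.

Arguments hom {c} a b : rename.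
Arguments idm {c} a : rename.
Arguments comp {_ a b c} g f : rename.

Notation "g ∘ f" := (comp g f) (at level 40, left associativity) : cat_scope.

Definition is_iso (C : category) (a b : C) (f : hom a b) : Prop :=
  exists g : hom b a, g ∘ f = idm a /\ f ∘ g = idm b.

Record functor (C D : category) : Type := Functor {
  fob :> C -> D;
  fmap : forall a b : C, hom a b -> hom (fob a) (fob b);
  fmap_id : forall a, fmap (idm a) = idm (fob a);
  fmap_comp : forall a b c (g : hom b c) (f : hom a b),
    fmap (g ∘ f) = fmap g ∘ fmap f }.

Arguments fmap {C D} F {a b} f : rename.

Definition id_functor (C : category) : functor C C :=
  @Functor C C (fun a => a) (fun a b f => f)
    (fun a => eq_refl) (fun a b c g f => eq_refl).

Lemma comp_functor_id (C D E : category) (G : functor D E) (F : functor C D) a :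
  fmap G (fmap F (idm a)) = idm (G (F a)).
Proof. by rewrite !fmap_id. Qed.

Lemma comp_functor_comp (C D E : category) (G : functor D E) (F : functor C D)
  a b c (g : hom b c) (f : hom a b) :
  fmap G (fmap F (g ∘ f)) = fmap G (fmap F g) ∘ fmap G (fmap F f).
Proof. by rewrite !fmap_comp. Qed.

Definition comp_functor (C D E : category) (G : functor D E) (F : functor C D) :
  functor C E :=
  @Functor C E (fun a => G (F a)) (fun a b f => fmap G (fmap F f))
    (comp_functor_id G F) (@comp_functor_comp C D E G F).

Record nat_trans (C D : category) (F G : functor C D) : Type := NatTrans {
  component :> forall a : C, hom (F a) (G a);
  naturality : forall (a b : C) (f : hom a b),
    component b ∘ fmap F f = fmap G f ∘ component a }.

(* [adjunction F G] : the data exhibiting [F] as left adjoint to [G]. *)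
Record adjunction (C D : category) (F : functor C D) (G : functor D C) : Type :=
  Adjunction {
  adj_unit : nat_trans (id_functor C) (comp_functor G F);
  adj_counit : nat_trans (comp_functor F G) (id_functor D);
  adj_triangle_left : forall c : C,
    adj_counit (F c) ∘ fmap F (adj_unit c) = idm (F c);
  adj_triangle_right : forall d : D,
    fmap G (adj_counit d) ∘ adj_unit (G d) = idm (G d) }.

Section ProductCategory.
Variables C D : category.

Let phom (x y : C * D) : Type := (hom x.1 y.1 * hom x.2 y.2)%type.
Let pid (x : C * D) : phom x x := (idm x.1, idm x.2).
Let pcomp (x y z : C * D) (g : phom y z) (f : phom x y) : phom x z :=
  (g.1 ∘ f.1, g.2 ∘ f.2).

Lemma prod_comp_idl x y (f : phom x y) : pcomp (pid y) f = f.
Proof. by case: f => f1 f2; rewrite /pcomp /= !comp_idl. Qed.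

Lemma prod_comp_idr x y (f : phom x y) : pcomp f (pid x) = f.
Proof. by case: f => f1 f2; rewrite /pcomp /= !comp_idr. Qed.

Lemma prod_comp_assoc x y z t (h : phom z t) (g : phom y z) (f : phom x y) :
  pcomp h (pcomp g f) = pcomp (pcomp h g) f.
Proof. by rewrite /pcomp /= !comp_assoc. Qed.

Definition prod_cat : category :=
  Category prod_comp_idl prod_comp_idr prod_comp_assoc.

End ProductCategory.

Definition bimap (C D E : category) (T : functor (prod_cat C D) E)
  (a a' : C) (b b' : D) (f : hom a a') (g : hom b b') :
  hom (T (a, b)) (T (a', b')) :=
  @fmap (prod_cat C D) E T (a, b) (a', b') (f, g).

Lemma bimap_id (C D E : category) (T : functor (prod_cat C D) E) a b :
  bimap T (idm a) (idm b) = idm (T (a, b)).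
Proof. exact: (fmap_id T (a, b)). Qed.

Lemma bimap_comp (C D E : category) (T : functor (prod_cat C D) E)
  (a a' a'' : C) (b b' b'' : D) (f' : hom a' a'') (f : hom a a')
  (g' : hom b' b'') (g : hom b b') :
  bimap T (f' ∘ f) (g' ∘ g) = bimap T f' g' ∘ bimap T f g.
Proof.
exact: (@fmap_comp _ _ T (a, b) (a', b') (a'', b'') (f', g') (f, g)).
Qed.


Record monoidal (C : category) : Type := Monoidal {
  tensor : functor (prod_cat C C) C;
  munit : C;
  assoc : forall a b c : C,
    hom (tensor (tensor (a, b), c)) (tensor (a, tensor (b, c)));
  lunit : forall a : C, hom (tensor (munit, a)) a;
  runit : forall a : C, hom (tensor (a, munit)) a;
  assoc_iso : forall a b c, is_iso (assoc a b c);
  lunit_iso : forall a, is_iso (lunit a);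
  runit_iso : forall a, is_iso (runit a);
  assoc_natural : forall a a' b b' c c'
      (f : hom a a') (g : hom b b') (h : hom c c'),
    assoc a' b' c' ∘ bimap tensor (bimap tensor f g) h =
    bimap tensor f (bimap tensor g h) ∘ assoc a b c;
  lunit_natural : forall a a' (f : hom a a'),
    lunit a' ∘ bimap tensor (idm munit) f = f ∘ lunit a;
  runit_natural : forall a a' (f : hom a a'),
    runit a' ∘ bimap tensor f (idm munit) = f ∘ runit a;
  pentagon : forall a b c d,
    assoc a b (tensor (c, d)) ∘ assoc (tensor (a, b)) c d =
    bimap tensor (idm a) (assoc b c d) ∘ assoc a (tensor (b, c)) d
      ∘ bimap tensor (assoc a b c) (idm d);
  triangle : forall a b,
    bimap tensor (idm a) (lunit b) ∘ assoc a munit b =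
    bimap tensor (runit a) (idm b) }.

Arguments tensor {C} M : rename.
Arguments munit {C} M : rename.
Arguments assoc {C} M a b c : rename.
Arguments lunit {C} M a : rename.
Arguments runit {C} M a : rename.

Notation "a *[ M ] b" := (tensor M (a, b))
  (at level 39, left associativity, format "a  *[ M ]  b") : cat_scope.
Notation "f **[ M ] g" := (bimap (tensor M) f g)
  (at level 39, left associativity, format "f  **[ M ]  g") : cat_scope.

Lemma tensor_comp (C : category) (M : monoidal C)
  (a a' a'' b b' b'' : C) (f' : hom a' a'') (f : hom a a')
  (g' : hom b' b'') (g : hom b b') :
  (f' ∘ f) **[M] (g' ∘ g) = (f' **[M] g') ∘ (f **[M] g).
Proof. exact: bimap_comp. Qed.

Record lax_monoidal (C D : category) (M : monoidal C) (N : monoidal D)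
  (F : functor C D) : Type := LaxMonoidal {
  lax_unit : hom (munit N) (F (munit M));
  lax_mul : forall a b : C, hom (F a *[N] F b) (F (a *[M] b));
  lax_mul_natural : forall a a' b b' (f : hom a a') (g : hom b b'),
    lax_mul a' b' ∘ (fmap F f **[N] fmap F g) =
    fmap F (f **[M] g) ∘ lax_mul a b;
  lax_assoc : forall a b c,
    fmap F (assoc M a b c) ∘ lax_mul (a *[M] b) c
      ∘ (lax_mul a b **[N] idm (F c)) =
    lax_mul a (b *[M] c) ∘ (idm (F a) **[N] lax_mul b c)
      ∘ assoc N (F a) (F b) (F c);
  lax_lunit : forall a,
    fmap F (lunit M a) ∘ lax_mul (munit M) a ∘ (lax_unit **[N] idm (F a)) =
    lunit N (F a);
  lax_runit : forall a,
    fmap F (runit M a) ∘ lax_mul a (munit M) ∘ (idm (F a) **[N] lax_unit) =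
    runit N (F a) }.

Section ProductMonoidal.
Variables (C D : category) (M : monoidal C) (N : monoidal D).

Local Notation CD := (prod_cat C D).

Let ptens_ob (p : prod_cat CD CD) : CD :=
  (p.1.1 *[M] p.2.1, p.1.2 *[N] p.2.2).
Let ptens_hom (p q : prod_cat CD CD) (f : hom p q) :
    hom (ptens_ob p) (ptens_ob q) :=
  (f.1.1 **[M] f.2.1, f.1.2 **[N] f.2.2).

Lemma prod_tensor_id p : ptens_hom (idm p) = idm (ptens_ob p).
Proof. by rewrite /ptens_hom /= !bimap_id. Qed.

Lemma prod_tensor_comp p q r (g : hom q r) (f : hom p q) :
  ptens_hom (g ∘ f) = ptens_hom g ∘ ptens_hom f.
Proof. by rewrite /ptens_hom /= !tensor_comp. Qed.

Definition prod_tensor : functor (prod_cat CD CD) CD :=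
  Functor prod_tensor_id prod_tensor_comp.

Lemma prod_iso (x y : CD) (f : hom x y) :
  is_iso f.1 -> is_iso f.2 -> is_iso f.
Proof.
case: f => f1 f2 /= [g1 [g1f f1g]] [g2 [g2f f2g]].
by exists (g1, g2); split; [congr pair|congr pair].
Qed.

Definition prod_monoidal : monoidal CD.
Proof.
refine (@Monoidal CD prod_tensor (munit M, munit N)
  (fun x y z => (assoc M x.1 y.1 z.1, assoc N x.2 y.2 z.2))
  (fun x => (lunit M x.1, lunit N x.2))
  (fun x => (runit M x.1, runit N x.2)) _ _ _ _ _ _ _ _).
- by move=> x y z; apply: prod_iso; apply: assoc_iso.
- by move=> x; apply: prod_iso; apply: lunit_iso.
- by move=> x; apply: prod_iso; apply: runit_iso.
- by move=> *; congr pair; apply: assoc_natural.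
- by move=> x y f; rewrite [RHS]surjective_pairing; congr pair; apply: lunit_natural.
- by move=> x y f; rewrite [RHS]surjective_pairing; congr pair; apply: runit_natural.
- by move=> *; congr pair; apply: pentagon.
- by move=> *; congr pair; apply: triangle.
Defined.

End ProductMonoidal.

(* No compatibility is imposed between the unit [munit otimes], or the
   associator and unitors of [otimes], and [box]: only the bifunctor [otimes]
   is lax monoidal. *)
Record lax2monoidal : Type := Lax2Monoidal {
  l2_cat :> category;
  box : monoidal l2_cat;
  otimes : monoidal l2_cat;
  l2_lax : lax_monoidal (prod_monoidal box box) box (tensor otimes) }.

Arguments box : clear implicits.
Arguments otimes : clear implicits.

Notation "a ⊠ b" := (a *[box _] b)
  (at level 39, left associativity) : cat_scope.
Notation "a ⊗ b" := (a *[otimes _] b)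
  (at level 39, left associativity) : cat_scope.
Notation "f ⊠ₘ g" := (f **[box _] g)
  (at level 39, left associativity) : cat_scope.
Notation "f ⊗ₘ g" := (f **[otimes _] g)
  (at level 39, left associativity) : cat_scope.

(* The types of [iota] and [interchange] hold by computation of the unit and
   tensor of [prod_monoidal]. *)
Definition iota (A : lax2monoidal) :
  hom (munit (box A)) (munit (box A) ⊗ munit (box A)) := lax_unit (l2_lax A).

Definition interchange (A : lax2monoidal) (a a' b b' : A) :
  hom ((a ⊗ a') ⊠ (b ⊗ b')) ((a ⊠ b) ⊗ (a' ⊠ b')) :=
  lax_mul (l2_lax A) (a, a') (b, b').

Section Monoids.
Variables (C : category) (M : monoidal C).

Record monoid : Type := Monoid {
  carrier :> C;
  mon_mul : hom (carrier *[M] carrier) carrier;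
  mon_unit : hom (munit M) carrier;
  mon_assoc : mon_mul ∘ (mon_mul **[M] idm carrier) =
    mon_mul ∘ (idm carrier **[M] mon_mul) ∘ assoc M carrier carrier carrier;
  mon_lunit : mon_mul ∘ (mon_unit **[M] idm carrier) = lunit M carrier;
  mon_runit : mon_mul ∘ (idm carrier **[M] mon_unit) = runit M carrier }.

Record monoid_hom (m n : monoid) : Type := MonoidHom {
  mhom :> hom (carrier m) (carrier n);
  mhom_mul : mhom ∘ mon_mul m = mon_mul n ∘ (mhom **[M] mhom);
  mhom_unit : mhom ∘ mon_unit m = mon_unit n }.

Lemma monoid_hom_eq (m n : monoid) (f g : monoid_hom m n) :
  mhom f = mhom g -> f = g.
Proof.
case: f g => [f f1 f2] [g g1 g2] /= fg; case: _ / fg in g1 g2 *.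
by rewrite (proof_irrelevance _ f1 g1) (proof_irrelevance _ f2 g2).
Qed.

Definition monoid_id (m : monoid) : monoid_hom m m.
Proof.
refine (@MonoidHom m m (idm (carrier m)) _ _).
- by rewrite bimap_id comp_idl comp_idr.
- by rewrite comp_idl.
Defined.

Definition monoid_comp (m n p : monoid)
  (g : monoid_hom n p) (f : monoid_hom m n) : monoid_hom m p.
Proof.
refine (@MonoidHom m p (mhom g ∘ mhom f) _ _).
- by rewrite -comp_assoc mhom_mul comp_assoc mhom_mul tensor_comp comp_assoc.
- by rewrite -comp_assoc !mhom_unit.
Defined.

Definition monoid_cat : category.
Proof.
refine (@Category monoid monoid_hom monoid_id monoid_comp _ _ _).
- by move=> m n f; apply: monoid_hom_eq; apply: comp_idl.
- by move=> m n f; apply: monoid_hom_eq; apply: comp_idr.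
- by move=> m n p q h g f; apply: monoid_hom_eq; apply: comp_assoc.
Defined.

Definition forget : functor monoid_cat C :=
  @Functor monoid_cat C carrier (fun m n f => mhom f)
    (fun m => eq_refl) (fun m n p g f => eq_refl).

End Monoids.

Section TensorOfMonoids.
Variable A : lax2monoidal.

Local Notation Mon := (monoid_cat (box A)).

Lemma interchange_natural (a a1 b b1 c c1 d d1 : A)
  (f : hom a a1) (g : hom b b1) (h : hom c c1) (k : hom d d1) :
  interchange a1 b1 c1 d1 ∘ ((f ⊗ₘ g) ⊠ₘ (h ⊗ₘ k)) =
  ((f ⊠ₘ h) ⊗ₘ (g ⊠ₘ k)) ∘ interchange a b c d.
Proof.
exact: (@lax_mul_natural _ _ _ _ _ (l2_lax A) (a, b) (a1, b1) (c, d) (c1, d1)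
  (f, g) (h, k)).
Qed.

Definition tensor_mul (m n : Mon) :
  hom ((carrier m ⊗ carrier n) ⊠ (carrier m ⊗ carrier n))
      (carrier m ⊗ carrier n) :=
  (mon_mul m ⊗ₘ mon_mul n)
    ∘ interchange (carrier m) (carrier n) (carrier m) (carrier n).

Definition tensor_unit (m n : Mon) :
  hom (munit (box A)) (carrier m ⊗ carrier n) :=
  (mon_unit m ⊗ₘ mon_unit n) ∘ iota A.

Lemma tensor_mon_assoc (m n : Mon) :
  tensor_mul m n ∘ (tensor_mul m n ⊠ₘ idm _) =
  tensor_mul m n ∘ (idm _ ⊠ₘ tensor_mul m n) ∘ assoc (box A) _ _ _.
Proof.
have L := lax_assoc (l2_lax A) (carrier m, carrier n) (carrier m, carrier n)
  (carrier m, carrier n).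
have {1}-> : idm (carrier m ⊗ carrier n) =
   (idm (carrier m) ⊗ₘ idm (carrier n)) ∘ idm (carrier m ⊗ carrier n).
  by rewrite bimap_id comp_idr.
have {2}-> : idm (carrier m ⊗ carrier n) =
   (idm (carrier m) ⊗ₘ idm (carrier n)) ∘ idm (carrier m ⊗ carrier n).
  by rewrite bimap_id comp_idr.
rewrite /tensor_mul !tensor_comp !comp_assoc.
rewrite -(comp_assoc (mon_mul m ⊗ₘ mon_mul n)) interchange_natural.
rewrite -[in RHS](comp_assoc (mon_mul m ⊗ₘ mon_mul n)) interchange_natural.
rewrite !comp_assoc -!bimap_comp !mon_assoc !bimap_comp.
by rewrite -!comp_assoc; congr comp; congr comp; rewrite !comp_assoc.
Qed.

Lemma tensor_mon_lunit (m n : Mon) :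
  tensor_mul m n ∘ (tensor_unit m n ⊠ₘ idm _) = lunit (box A) _.
Proof.
have L := lax_lunit (l2_lax A) (carrier m, carrier n).
have {1}-> : idm (carrier m ⊗ carrier n) =
   (idm (carrier m) ⊗ₘ idm (carrier n)) ∘ idm (carrier m ⊗ carrier n).
  by rewrite bimap_id comp_idr.
rewrite /tensor_mul /tensor_unit tensor_comp comp_assoc.
rewrite -(comp_assoc (mon_mul m ⊗ₘ mon_mul n)) interchange_natural.
by rewrite comp_assoc -bimap_comp !mon_lunit.
Qed.

Lemma tensor_mon_runit (m n : Mon) :
  tensor_mul m n ∘ (idm _ ⊠ₘ tensor_unit m n) = runit (box A) _.
Proof.
have L := lax_runit (l2_lax A) (carrier m, carrier n).
have {1}-> : idm (carrier m ⊗ carrier n) =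
   (idm (carrier m) ⊗ₘ idm (carrier n)) ∘ idm (carrier m ⊗ carrier n).
  by rewrite bimap_id comp_idr.
rewrite /tensor_mul /tensor_unit tensor_comp comp_assoc.
rewrite -(comp_assoc (mon_mul m ⊗ₘ mon_mul n)) interchange_natural.
by rewrite comp_assoc -bimap_comp !mon_runit.
Qed.

Definition tensor_mon (m n : Mon) : Mon :=
  Monoid (tensor_mon_assoc m n) (tensor_mon_lunit m n) (tensor_mon_runit m n).

(* The action of [tensor_mon] on morphisms; its underlying arrow is
   [f ⊗ₘ g]. *)
Definition tensor_mon_hom (m m' n n' : Mon) (f : hom m m') (g : hom n n') :
  hom (tensor_mon m n) (tensor_mon m' n').
Proof.
refine (@MonoidHom _ _ (tensor_mon m n) (tensor_mon m' n')
  (mhom f ⊗ₘ mhom g) _ _).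
- rewrite /= /tensor_mul comp_assoc -bimap_comp !mhom_mul bimap_comp.
  by rewrite -!comp_assoc interchange_natural.
- by rewrite /= /tensor_unit comp_assoc -bimap_comp !mhom_unit.
Defined.

End TensorOfMonoids.

(* Main.v *)
From Stdlib Require Import ssreflect.
Require Import Defs.
Open Scope cat_scope.

(** For free monoids [F V] and [F W], the units of the adjunction are arrows
    [V -> F V] and [W -> F W] of [A]; tensoring them gives an arrow
    [V ⊗ W -> F V ⊗ F W].  Its target carries a [⊠]-monoid structure because
    [⊗] is lax monoidal, so the universal property of the free monoid extends
    this arrow uniquely to a morphism of monoids
    [F (V ⊗ W) -> F V ⊗ F W], which is [Phi].

    Naturality holds because transposition along an adjunction carries
    commutative squares in [A] to commutative squares of monoids
    ([transpose_square]).  The square to transpose is the image under [⊗] of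
    the two naturality squares of the unit of the adjunction; it lifts to
    monoids because [fmap F f ⊗ₘ fmap F g] is the arrow underlying a monoid
    morphism. *)

Definition transpose {C D : category} {F : functor C D} {G : functor D C}
    (adj : adjunction F G) {c : C} {d : D} (u : hom c (G d)) : hom (F c) d :=
  adj_counit adj d ∘ fmap F u.

(** Transposition is natural in both variables at once; stating it for squares
    avoids separate rules for precomposition and postcomposition. *)
Lemma transpose_square {C D : category} {F : functor C D} {G : functor D C}
    (adj : adjunction F G) {c c' : C} {d d' : D}
    (u : hom c (G d)) (u' : hom c' (G d')) (p : hom c c') (q : hom d d') :
  u' ∘ p = fmap G q ∘ u ->
  transpose adj u' ∘ fmap F p = q ∘ transpose adj u.
Proof.
move=> sq; rewrite /transpose -comp_assoc -fmap_comp sq fmap_comp !comp_assoc.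
by have /= -> := naturality (adj_counit adj) q.
Qed.

Theorem proposition10 (A : lax2monoidal)
  (F : functor A (monoid_cat (box A)))
  (adj : adjunction F (forget (box A))) :
  exists Phi : forall V W : A,
      @hom (monoid_cat (box A)) (F (V ⊗ W)) (tensor_mon (F V) (F W)),
    forall (V V' W W' : A) (f : hom V V') (g : hom W W'),
      Phi V' W' ∘ fmap F (f ⊗ₘ g) =
      tensor_mon_hom (fmap F f) (fmap F g) ∘ Phi V W.
Proof.
pose eta := adj_unit adj.
exists (fun V W =>
  transpose adj (d := tensor_mon (F V) (F W)) (eta V ⊗ₘ eta W)).
move=> V V' W W' f g; apply: transpose_square.
have /= nat_f := naturality eta f.
have /= nat_g := naturality eta g.
by rewrite /= -!tensor_comp -nat_f -nat_g.
Qed.
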